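(* Let $(X_n:n\in\omega)$ be a sequentially absorbing covering of a topological space $X$. Then the following hold. (1) If $Y$ is a topological space and $f:X\to Y$ is a map such that $f|_{X_n}$ is continuous for all $n\in\omega$, then $f$ is sequentially continuous on $X$. (2) If $Y$ is a first countable topological space and $f:Y\to X$ is continuous, then for any $y\in Y$ there exist a neighborhood $U$ of $y$ in $Y$ and a number $n\in\omega$ such that $f(U)\subseteq X_n$. (3) If each $X_n$ is Hausdorff and $X$ is a first countable space, then $X$ is Hausdorff. (4) If each $X_n$ is regular and $X$ is a Fréchet–Urysohn space, then $X$ is regular. (5) If each $X_n$ is normal (respectively, perfectly normal) and $X$ is a sequential space, then $X$ is normal (respectively, perfectly normal). (6) If each $X_n$ is metrizable and $X$ is a first countable space, then $X$ is metrizable.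
   Context: A countable covering $(X_n:n\in\omega)$ of a topological space $X$ is called sequentially absorbing if for any convergent sequence $(x_n)_{n\in\omega}$ in $X$ there exists $k\in\omega$ such that $\{x_n:n\in\omega\}\subseteq X_k$. Standing assumption: every sequentially absorbing covering is moreover assumed to be closed (each $X_n$ is closed in $X$) and increasing ($X_n\subseteq X_{n+1}$ for all $n$). Each $X_n$ carries the subspace topology. Separation axioms follow Engelking's conventions: regular, normal and perfectly normal spaces are assumed to be $T_1$. A space is perfectly normal if it is normal and every closed subset is $G_\delta$. *)

(* Defs.v *)
From HB Require Import structures.
From mathcomp Require Import all_boot all_order all_algebra.
From mathcomp Require Import all_classical all_reals all_analysis.
From mathcomp Require Import borel_hierarchy.

Set Implicit Arguments.
Unset Strict Implicit.
Unset Printing Implicit Defensive.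

Import Order.TTheory GRing.Theory Num.Theory.

Local Open Scope classical_set_scope.
Local Open Scope ring_scope.

(* The members [X_ n] of a covering are sets in [X]; used as types they are
   coerced to [set_type (X_ n)], whose library topology is the initial topology
   of the inclusion, i.e. the subspace topology. *)

(* [X] need not be Hausdorff, so convergence is stated with an explicit limit
   point; the limit itself is not required to lie in the range. *)
Definition sequentially_absorbing (X : topologicalType) (X_ : nat -> set X) :=
  [/\ \bigcup_n X_ n = [set: X],
      forall n, closed (X_ n),
      forall n, X_ n `<=` X_ n.+1 &
      forall (x : nat -> X) (l : X),
        x n @[n --> \oo] --> l -> exists k, range x `<=` X_ k].

Definition sequentially_continuous (X Y : topologicalType) (f : X -> Y) :=
  forall (x : nat -> X) (l : X),
    x n @[n --> \oo] --> l -> f (x n) @[n --> \oo] --> f l.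

Definition first_countable_space (X : topologicalType) :=
  forall x : X, exists B : set (set X),
    [/\ countable B,
        forall U, B U -> open_nbhs x U &
        forall V, nbhs x V -> exists2 U, B U & U `<=` V].

Definition frechet_urysohn_space (X : topologicalType) :=
  forall (A : set X) (l : X), closure A l ->
    exists2 x : nat -> X, (forall n, A (x n)) & x n @[n --> \oo] --> l.

Definition sequentially_closed (X : topologicalType) (A : set X) :=
  forall (x : nat -> X) (l : X),
    (forall n, A (x n)) -> x n @[n --> \oo] --> l -> A l.

Definition sequential_space (X : topologicalType) :=
  forall A : set X, sequentially_closed A -> closed A.

(* The library's [regular_space] and [normal_space] do not include T1. *)
Definition T1_regular_space (X : topologicalType) :=
  accessible_space X /\ regular_space X.

Definition T1_normal_space (X : topologicalType) :=
  accessible_space X /\ normal_space X.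

Definition perfectly_normal_space (X : topologicalType) :=
  T1_normal_space X /\ forall A : set X, closed A -> Gdelta A.

(* Some [R]-valued metric-space structure [m] on the carrier of [X] induces the
   topology of [X]. *)
Definition metrizable_space (R : realType) (X : topologicalType) :=
  exists m : Metric R X,
    forall A : set X, @open (Metric.Pack m) A <-> @open X A.

Section metrizableP.
Variables (R : realType) (X : topologicalType) (d : X -> X -> R).
Hypothesis dxx : forall x, d x x = 0.
Hypothesis d_eq0 : forall x y, d x y = 0 -> x = y.
Hypothesis d_sym : forall x y, d x y = d y x.
Hypothesis d_tri : forall y x z, d x z <= d x y + d y z.

Definition metric_copy : Type := X.
HB.instance Definition _ := Choice.on metric_copy.
HB.instance Definition _ := @isMetric.Build R metric_copy d dxx d_eq0 d_sym d_tri.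

Lemma dist_metrizable :
  (forall (x : X) (A : set X),
     nbhs x A <-> exists2 e, 0 < e & [set y | d x y < e] `<=` A) ->
  metrizable_space R X.
Proof.
move=> dA; exists (Metric.on metric_copy) => A.
rewrite !openE; split=> + x Ax => /(_ x Ax).
  rewrite /interior /= => h; apply/dA.
  by case: ((@nbhs_ballP R metric_copy x A).1 h) => e e0 eA; exists e.
rewrite /interior /= => /dA[e e0 eA].
by apply: (@nbhs_ballP R metric_copy x A).2; exists e.
Qed.

End metrizableP.

Lemma metrizable_spaceP (R : realType) (X : topologicalType) :
  metrizable_space R X <->
  exists d : X -> X -> R,
    [/\ forall x, d x x = 0, forall x y, d x y = 0 -> x = y,
        forall x y, d x y = d y x, forall y x z, d x z <= d x y + d y z &
        forall (x : X) (A : set X),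
          nbhs x A <-> exists2 e, 0 < e & [set y | d x y < e] `<=` A].
Proof.
split=> [[m mP]|[d [d1 d2 d3 d4 dA]]]; last exact: (dist_metrizable d1 d2 d3 d4).
pose M : metricType R := Metric.Pack m.
exists (@mdist R M); split=> [x|x y|x y|y x z|x A].
- exact: mdistxx.
- exact: mdist_positivity.
- exact: metric_sym.
- exact: metric_triangle.
have -> : nbhs x A <-> @nbhs M M x A.
  by rewrite !nbhsE; split=> -[U [oU Ux] UA]; exists U => //; split=> //; exact/mP.
split=> [/(@nbhs_ballP R M x A)[e e0 eA]|[e e0 eA]].
  by exists e => //; move: eA; rewrite ballEmdist.
by apply: (@nbhs_ballP R M x A).2; exists e => //; rewrite ballEmdist.
Qed.

(* Main.v *)
(* A convergent sequence, together with its limit, lives in one X_ k, so limits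
   can be computed there; if the source is first countable, a neighbourhood base
   not eventually mapped into some X_ n would yield a convergent sequence
   escaping every X_ n.
   Regularity: given x in U, pick neighbourhoods W n of x with
   closure (W n `&` X_ n) `<=` U and keep the points z lying in W n for the
   least n with X_ n z.
   Normality: grow disjoint closed pairs (P n, Q n) of X_ n, each P n interior
   to P n.+1 relative to X_ n.+1, and likewise for Q; both unions are
   sequentially open.
   Perfect normality: an open subset of X_ n is a countable union of closed
   subsets of X_ n, and these are closed in X.
   Metrizability: the interiors of the X_ n cover X and are F-sigma, so Urysohn
   functions give countably many bumps phi n <= 1/(n+1), each positive only
   inside some member metrized by a distance d n, whose supports cover X.  The
   functions min(phi n, 1) and min(phi n, d n a) form an equicontinuous family
   that separates points from closed sets, and the supremum of the differences
   of its members is a metric for X. *)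
Require Import Defs.
From mathcomp Require Import all_boot all_order all_algebra.
From mathcomp Require Import all_classical all_reals all_analysis.
From mathcomp Require Import borel_hierarchy lra.

Set Implicit Arguments.
Unset Strict Implicit.
Unset Printing Implicit Defensive.

Import Order.TTheory GRing.Theory Num.Theory.
Import numFieldNormedType.Exports.

Local Open Scope classical_set_scope.

(** * Neighbourhoods, convergence and closed sets in a subspace *)

Section subspace.
Variables (X : topologicalType) (A : set X).

Lemma nbhs_set_typeP (x : A) (U : set A) :
  nbhs x U <-> within A (nbhs (\val x)) (set_val @` U).
Proof.
split=> [[_ [[W oW <-] Wx WU]]|].
  rewrite set_valE /= in Wx WU.
  have xW : nbhs (\val x) W by apply: open_nbhs_nbhs; split.
  by apply: (@filterS _ (nbhs (\val x)) _ W _ _ xW) => y Wy Ay;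
     exists (SigSub (mem_set Ay)) => //; exact: WU.
rewrite /within /= => U1.
have := @initial_continuous A X set_val x; rewrite set_valE => /(_ _ U1).
by apply: (@filterS _ (nbhs x)) => y /(_ (set_valP y))[z Uz /val_inj <-].
Qed.

Lemma cvg_set_type (u : nat -> A) (l : A) :
  \val (u n) @[n --> \oo] --> \val l -> u n @[n --> \oo] --> l.
Proof.
move=> ul U /nbhs_set_typeP /ul; rewrite /= /nbhs /=.
by apply: filterS => n /= /(_ (set_valP _))[z Uz /val_inj <-].
Qed.

Lemma closed_set_val (F : set A) : closed A -> closed F -> closed (set_val @` F).
Proof.
move=> cA cF x clFx.
have Ax : A x.
  apply: cA => V /clFx[_ [[y Fy <-] Vy]].
  by exists (set_val y); split => //; exact: set_valP.
exists (SigSub (mem_set Ax)) => //; apply: cF => V /nbhs_set_typeP /clFx.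
move=> [_ [[y Fy <-]]] /(_ (set_valP _))[z Vz /val_inj zy].
by exists z; split; rewrite // zy.
Qed.

End subspace.

(** * Sequences in first countable, Fréchet-Urysohn and sequential spaces *)

Section sequences.
Variable X : topologicalType.

(** Picking [u n] from [P n] inside the first n+1 sets of an enumerated base forces convergence. A
    varying [P] lets the sequence escape a covering; a constant [P] gives the Fréchet-Urysohn
    property. *)
Lemma first_countable_cvg (x : X) (P : nat -> set X) :
  first_countable_space X ->
  (forall n V, nbhs x V -> V `&` P n !=set0) ->
  exists2 u : nat -> X, u n @[n --> \oo] --> x & forall n, P n (u n).
Proof.
move=> /(_ x)[B [cB Bx xB]] xP.
have [e eB] : exists e : nat -> set X, set_surj setT B e by exact/pcard_surjP.
have [e' He] : exists e' : nat -> set X,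
    (forall n, nbhs x (e' n)) /\ forall V, nbhs x V -> exists n, e' n `<=` V.
  (* The surjection [e] may take values outside [B]; these become [setT], so that every term is a
     neighbourhood of [x]. *)
  exists (fun n => if `[< B (e n) >] then e n else setT); split.
    by move=> n; case: asboolP => [/Bx /open_nbhs_nbhs//|_]; exact: filterT.
  move=> V /xB[U BU UV]; have [n _ enU] := eB U BU.
  by exists n; rewrite enU asboolT.
pose W n := [set y | forall i : 'I_n.+1, e' i y].
have xW n : nbhs x (W n) by apply: filter_forall => i; exact: He.1.
have /choice[u uP] : forall n, exists y, (W n `&` P n) y by move=> n; exact: xP.
exists u => [V /He.2[n enV]|n]; last by have [] := uP n.
exists n => // m /= nm; apply: enV.
by have [/(_ (Ordinal (n:=m.+1) (m:=n) nm))] := uP m.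
Qed.

Lemma first_countable_frechet_urysohn :
  first_countable_space X -> frechet_urysohn_space X.
Proof.
move=> fcX A l clAl.
have [|u ul Au] := @first_countable_cvg l (fun=> A) fcX; last by exists u.
by move=> _ V /clAl; rewrite setIC.
Qed.

Lemma frechet_urysohn_sequential :
  frechet_urysohn_space X -> sequential_space X.
Proof. by move=> fuX A sA l /fuX[u Au ul]; exact: sA ul. Qed.

Lemma frechet_urysohn_nbhs (x : X) (V : set X) : frechet_urysohn_space X ->
  (forall u : nat -> X, u n @[n --> \oo] --> x -> exists n, V (u n)) ->
  nbhs x V.
Proof.
move=> fuX xV; apply: contrapT => nxV.
have [u uV /xV[n]] : exists2 u : nat -> X, (forall n, (~` V) (u n)) &
    u n @[n --> \oo] --> x; last exact: uV.
apply: fuX => B xB; apply: contrapT => VB0; apply: nxV.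
by apply: filterS xB => y By; apply: contrapT => nVy; apply: VB0; exists y.
Qed.

Lemma sequential_open (U : set X) : sequential_space X ->
  (forall (u : nat -> X) l, u n @[n --> \oo] --> l -> U l -> exists n, U (u n)) ->
  open U.
Proof.
move=> sX sU; rewrite -closedC; apply: sX => u l nU ul Ul.
by have [n] := sU _ _ ul Ul; exact: nU.
Qed.

End sequences.

(** * Metrizable spaces and metrization by families of functions *)

Section metrizable.
Variables (R : realType) (X : topologicalType).
Local Open Scope ring_scope.

Lemma metrizable_normal : metrizable_space R X -> normal_space X.
Proof.
move=> [m mX]; pose M : metricType R := Metric.Pack m.
have mXc (A : set X) : @closed X A -> @closed M A.
  by rewrite -openC -[in X in _ -> X]openC => /mX.
have /(@normal_openP R) nM := @pseudometric_normal R M.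
apply/(@normal_openP R) => A B /mXc cA /mXc cB AB0.
have [U [V [oU oV AU BV UV0]]] := nM _ _ cA cB AB0.
by exists U, V; split=> //; exact/mX.
Qed.

Lemma metrizable_accessible : metrizable_space R X -> accessible_space X.
Proof.
move=> [m mX]; pose M : metricType R := Metric.Pack m.
move=> x y /eqP xy; have /eqP Mxy : (x : M) <> y by [].
have [A [oA Ax Ay]] := hausdorff_accessible (@metric_hausdorff R M) Mxy.
by exists A; split=> //; exact/mX.
Qed.

Lemma metrizable_Gdelta (A : set X) :
  metrizable_space R X -> closed A -> Gdelta A.
Proof.
move=> /metrizable_spaceP[d [dxx _ dC _ dX]] cA.
(* The 1/(n+1)-enlargement of [A]; interiors spare a proof that balls are open. *)
pose G n := \bigcup_(a in A) [set y | d a y < n.+1%:R^-1]°.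
exists G; first by move=> n; apply: bigcup_open => a _; exact: open_interior.
apply/seteqP; split=> x.
  move=> Ax n _; exists x => //; apply/dX.
  by exists n.+1%:R^-1; [rewrite invr_gt0|].
move=> Gx; apply: cA => V /dX[e e0 eV].
have [N _ /(_ N (leqnn N))/= Ne] := near_infty_natSinv_lt (PosNum e0).
have [a Aa /interior_subset/= ax] := Gx N I.
by exists a; split=> //; apply: eV; rewrite /= dC (lt_trans ax).
Qed.

(** Extending the distance of [A] to all of [X] lets the metrics of different members enter one
    family of functions on [X]. *)
Lemma metrizable_set_dist (A : set X) : metrizable_space R A ->
  exists d : X -> X -> R, [/\ forall x y, 0 <= d x y,
    forall x, A x -> d x x = 0,
    forall a x y, A x -> A y -> `|d a x - d a y| <= d x y,
    forall x e, A x -> 0 < e -> within A (nbhs x) [set y | d x y < e] &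
    forall x (V : set X), A x -> nbhs x V ->
      exists2 e, 0 < e & forall y, A y -> d x y < e -> V y].
Proof.
move=> /metrizable_spaceP[d [dxx _ dC dD dA]].
(* The default 1 makes [D a] constant on [A] when [a] is outside [A], so the Lipschitz bound holds
   for every [a]. *)
pose D (x y : X) : R := if (insub x : option A, insub y : option A)
  is (Some x', Some y') then d x' y' else 1.
have DE (x y : A) : D (\val x) (\val y) = d x y by rewrite /D !valK.
have inA x : A x -> exists x' : A, x = \val x'.
  by move=> Ax; exists (SigSub (mem_set Ax)).
have d0 x y : 0 <= d x y.
  by have := dD y x x; rewrite dxx [d y x]dC -mulr2n pmulrn_lge0.
exists D; split.
- by move=> x y; rewrite /D; case: insub => // x'; case: insub.
- by move=> x /inA[x' ->]; rewrite DE.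
- move=> a x y /inA[x' ->] /inA[y' ->]; rewrite DE.
  have [/inA[a' ->]|nAa] := pselect (A a); last first.
    rewrite /D insubF ?subrr ?normr0//; apply/negbTE/negP => /set_mem.
    exact: nAa.
  rewrite !DE ler_norml; have := dD x' a' y'; have := dD y' a' x'.
  rewrite [d y' x']dC; lra.
- move=> x e /inA[x' ->] e0.
  have /nbhs_set_typeP : nbhs x' [set y | d x' y < e] by apply/dA; exists e.
  rewrite /within /=; apply: filterS => y /[apply] -[y' xy' <-].
  by rewrite -[set_val y']/(\val y') DE.
- move=> x V /inA[x' ->] xV.
  have /dA[e e0 eV] : nbhs x' (set_val @^-1` V) by exact: initial_continuous.
  by exists e => // y /inA[y' ->]; rewrite DE => /eV.
Qed.

(** The metric is the supremum of [|F i x - F i y|], finite since values lie in [0, 1].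
    Equicontinuity makes its balls neighbourhoods, separation puts a ball inside each neighbourhood,
    and with T1 distinct points get positive distance. *)
Lemma equicontinuous_metrizable (I : Type) (i0 : I) (F : I -> X -> R) :
  accessible_space X ->
  (forall i x, 0 <= F i x <= 1) ->
  (forall x e, 0 < e -> \forall y \near x, forall i, `|F i x - F i y| <= e) ->
  (forall x V, nbhs x V -> exists2 e, 0 < e &
     forall y, (forall i, `|F i x - F i y| < e) -> V y) ->
  metrizable_space R X.
Proof.
move=> T1 F01 Fcont Fsep.
pose d x y := sup (range (fun i => `|F i x - F i y|)).
have Fd i x y : `|F i x - F i y| <= d x y.
  apply: ub_le_sup; last by exists i.
  exists 1 => _ [j _ <-]; rewrite ler_norml.
  by have := F01 j x; have := F01 j y; lra.
have d_le x y c : (forall i, `|F i x - F i y| <= c) -> d x y <= c.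
  by move=> Fc; apply: ge_sup => [|_ [i _ <-]//]; exists `|F i0 x - F i0 y|, i0.
have dsep x V : nbhs x V -> exists2 e, 0 < e & forall y, d x y < e -> V y.
  move=> /Fsep[e e0 eV]; exists e => // y xy; apply: eV => i.
  exact: le_lt_trans xy.
have d0 x y : 0 <= d x y by apply: le_trans (Fd i0 x y).
apply/metrizable_spaceP; exists d; split.
- move=> x; apply/eqP; rewrite eq_le d0 andbT; apply: d_le => i.
  by rewrite subrr normr0.
- move=> x y dxy; apply: contrapT => /eqP /T1[U [oU]].
  rewrite !inE => Ux nUy; have [|e e0] := dsep x U; first exact: open_nbhs_nbhs.
  by move=> /(_ y); rewrite dxy => /(_ e0).
- by move=> x y; congr sup; congr (_ @` _); apply/funext => i; rewrite distrC.
- move=> y x z; apply: d_le => i; apply: le_trans (ler_distD (F i y) _ _) _.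
  by apply: lerD; exact: Fd.
- move=> x V; split=> [/dsep//|[e e0 eV]].
  (* A supremum preserves only the weak bound, so [e / 2] is needed to end strictly below [e]. *)
  have e20 : 0 < e / 2 by rewrite divr_gt0.
  apply: filterS (Fcont x _ e20) => y Fxy; apply: eV => /=.
  by apply: (le_lt_trans (d_le _ _ _ Fxy)); lra.
Qed.

Lemma ler_dist_min (a b a' b' e : R) : `|a - a'| <= e -> `|b - b'| <= e ->
  `|Num.min a b - Num.min a' b'| <= e.
Proof.
by rewrite !ler_norml; case: (lerP a b); case: (lerP a' b'); lra.
Qed.

(** Equicontinuity of one bump's family: [None] stands for min(phi, 1), [Some a] for min(phi, d a).
    Where phi vanishes, phi alone bounds every minimum; where it is positive, nearby points stay in
    [A], and the Lipschitz bound is uniform in [a]. *)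
Lemma bump_near (A : set X) (d : X -> X -> R) (phi : X -> R) x (e : R) :
  (forall x y, 0 <= d x y) ->
  (forall a x y, A x -> A y -> `|d a x - d a y| <= d x y) ->
  (forall x e, A x -> 0 < e -> within A (nbhs x) [set y | d x y < e]) ->
  continuous phi -> (forall x, 0 <= phi x) -> (forall x, 0 < phi x -> A x) ->
  0 < e ->
  \forall y \near x, forall o : option X,
    `|Num.min (phi x) (oapp (d^~ x) 1 o) - Num.min (phi y) (oapp (d^~ y) 1 o)|
      <= e.
Proof.
move=> d0 dL dA phiC phi0 phiA e0.
have phi_near : \forall y \near x, `|phi x - phi y| <= e.
  by have /cvgrPdist_le := phiC x; apply.
have [phix|phix] := leP (phi x) 0.
  have {}phix : phi x = 0 by apply/eqP; rewrite eq_le phix phi0.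
  apply: filterS phi_near => y; rewrite phix sub0r normrN ger0_norm// => phiy o.
  have o0 z : 0 <= oapp (d^~ z) 1 o by case: o => //= a.
  rewrite min_l// sub0r normrN ger0_norm ?le_min ?phi0 ?o0//.
  by rewrite ge_min phiy.
have phi_gt0 : \forall y \near x, 0 < phi y.
  by have /cvgr_gt := phiC x; apply.
have Ax := phiA _ phix.
have := dA _ _ Ax e0; rewrite /within /= => dnear.
apply: filterS3 phi_near phi_gt0 dnear => y phixy phiy dxy [a|] /=.
  apply: ler_dist_min => //; have Ay := phiA _ phiy.
  exact: le_trans (dL a _ _ Ax Ay) (ltW (dxy Ay)).
by apply: ler_dist_min => //; rewrite subrr normr0 ltW.
Qed.

Lemma bumps_metrizable (A : nat -> set X) (phi : nat -> X -> R) :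
  accessible_space X ->
  (forall n, metrizable_space R (A n)) ->
  (forall n, continuous (phi n)) ->
  (forall n x, 0 <= phi n x <= n.+1%:R^-1) ->
  (forall n x, 0 < phi n x -> A n x) ->
  (forall x, exists n, 0 < phi n x) ->
  metrizable_space R X.
Proof.
move=> T1 mA phiC phi01 phiA phi_gt0.
have phi0 n x : 0 <= phi n x by have /andP[] := phi01 n x.
have phi1 n x : phi n x <= 1.
  have /andP[_ /le_trans] := phi01 n x; apply.
  by rewrite invf_le1// ler1n.
have /choice[d dP] := fun n => metrizable_set_dist (mA n).
pose F (i : nat * option X) x :=
  Num.min (phi i.1 x) (oapp ((d i.1)^~ x) 1 i.2).
have F0 i x : 0 <= F i x.
  rewrite /F le_min phi0; case: i => n [a|]//=.
  by have [] := dP n.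
have Fphi i x : F i x <= phi i.1 x by rewrite ge_min lexx.
apply: (@equicontinuous_metrizable _ (0%N, None) F) => //.
- by move=> i x; rewrite F0 (le_trans (Fphi i x)).
- move=> x e e0.
  (* From index [N] on, every function has values in [0, e]; only finitely many bumps remain to be
     controlled near [x]. *)
  have [N _ Ne] := near_infty_natSinv_lt (PosNum e0).
  have : \forall y \near x, forall n : 'I_N, forall o,
      `|F (val n, o) x - F (val n, o) y| <= e.
    apply: filter_forall => n; have [d0 _ dL dA _] := dP n.
    exact: (bump_near x d0 dL dA (phiC n) (phi0 n) (phiA n) e0).
  apply: filterS => y Fy [n o].
  have [nN|Nn] := ltnP n N; first exact: (Fy (Ordinal nN)).
  have small z : 0 <= F (n, o) z <= e.
    rewrite F0 (le_trans (Fphi _ _))//; have /andP[_ /le_trans] := phi01 n z.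
    by apply; exact/ltW/(Ne n Nn).
  by have := small x; have := small y; rewrite ler_norml; lra.
- move=> x V xV; have [n phix] := phi_gt0 x.
  have [d0 dxx _ _ dV] := dP n; have Ax := phiA _ _ phix.
  have [r r0 rV] := dV x V Ax xV.
  (* The [None] function forces [phi n y > phi n x / 2], hence [y] in [A n]. The [Some x] function
     vanishes at [x], and its minimum at [y] is then too small to be [phi n y], so [d n x y < r]. *)
  exists (Num.min (phi n x / 2) r); first by rewrite lt_min r0 divr_gt0.
  move=> y Fxy.
  have := Fxy (n, None); rewrite /F /= (min_l (phi1 n x)) (min_l (phi1 n y)).
  rewrite lt_min => /andP[+ _]; rewrite ltr_norml => /andP[_ phixy].
  have phiy : phi n x / 2 < phi n y by lra.
  have Ay : A n y by apply: phiA; apply: lt_trans phiy; rewrite divr_gt0.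
  apply: rV => //; have := Fxy (n, Some x).
  rewrite /F /= dxx// min_r// sub0r normrN ger0_norm ?le_min ?phi0 ?d0//.
  by rewrite gt_min !lt_min; lra.
Qed.

End metrizable.

(** * Absorbing coverings: continuity, Hausdorffness, T1 and regularity *)

Section absorbing.
Variables (X : topologicalType) (X_ : nat -> set X).
Hypothesis hX : sequentially_absorbing X_.

Lemma absorbing_closed n : closed (X_ n).
Proof. by have [] := hX. Qed.

Lemma absorbing_le m n : (m <= n)%N -> X_ m `<=` X_ n.
Proof.
have [_ _ XS _] := hX; apply: (homo_leq _ _ XS) => [A|A B C]//.
exact: subset_trans.
Qed.

Lemma absorbing_mem (x : X) : exists n, X_ n x.
Proof.
by have [X_T _ _ _] := hX; have [n _ ?] : (\bigcup_n X_ n) x; [rewrite X_T|exists n].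
Qed.

Lemma absorbing_cvg (u : nat -> X) (l : X) : u n @[n --> \oo] --> l ->
  exists k, (forall n, X_ k (u n)) /\ X_ k l.
Proof.
move=> ul; have [_ _ _ /(_ _ _ ul)[k uk]] := hX.
have {}uk n : X_ k (u n) by apply: uk; exists n.
exists k; split=> //; apply: (closed_cvg _ (absorbing_closed (n := k)) _ _ ul).
exact: nearW.
Qed.

Lemma absorbing_sequentially_continuous (Y : topologicalType) (f : X -> Y) :
  (forall n, continuous (sigL (X_ n) f)) -> sequentially_continuous f.
Proof.
move=> cf u l ul; have [k [uk lk]] := absorbing_cvg ul.
pose v n : X_ k := SigSub (mem_set (uk n)).
have vl : v n @[n --> \oo] --> (SigSub (mem_set lk) : X_ k).
  exact: cvg_set_type.
exact: (cvg_comp _ _ vl (cf k _)).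
Qed.

Lemma absorbing_nbhs_image (Y : topologicalType) (f : Y -> X) :
  first_countable_space Y -> continuous f ->
  forall y : Y, exists U n, nbhs y U /\ f @` U `<=` X_ n.
Proof.
move=> fcY cf y; apply: contrapT => nU.
have [n V yV|u uy uX] :=
    @first_countable_cvg Y y (fun n => ~` (f @^-1` X_ n)) fcY.
  apply: contrapT => VX; apply: nU; exists V, n; split=> // _ [z Vz <-].
  by apply: contrapT => nXz; apply: VX; exists z.
have [k [fuk _]] := absorbing_cvg (cvg_comp _ _ uy (cf y)).
exact: (uX k).
Qed.

Lemma absorbing_first_countable_nbhs : first_countable_space X ->
  forall x : X, exists n, nbhs x (X_ n).
Proof.
move=> fcX x.
have [|U [n [xU UX]]] := @absorbing_nbhs_image X id fcX _ x; first by move=> ?.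
by exists n; apply: filterS xU => y Uy; apply: UX; exists y.
Qed.

(** Some [X_ k] is a neighbourhood of both points, so neighbourhoods relative to it are
    neighbourhoods in [X]. *)
Lemma absorbing_hausdorff : (forall n, hausdorff_space (X_ n)) ->
  first_countable_space X -> hausdorff_space X.
Proof.
move=> hX_ fcX x y xy.
have [m xm] := absorbing_first_countable_nbhs fcX x.
have [n yn] := absorbing_first_countable_nbhs fcX y.
pose k := maxn m n.
have {}xm : nbhs x (X_ k).
  by apply: filterS xm; apply: absorbing_le; exact: leq_maxl.
have {}yn : nbhs y (X_ k).
  by apply: filterS yn; apply: absorbing_le; exact: leq_maxr.
pose x' : X_ k := SigSub (mem_set (nbhs_singleton xm)).
pose y' : X_ k := SigSub (mem_set (nbhs_singleton yn)).
suff : x' = y' by move/(congr1 \val).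
apply: hX_ => A B /nbhs_set_typeP xA /nbhs_set_typeP yB.
have {}xA : nbhs x (set_val @` A).
  exact: (@filter_app _ (nbhs x) _ _ _ xA).
have {}yB : nbhs y (set_val @` B).
  exact: (@filter_app _ (nbhs y) _ _ _ yB).
have [_ [[z Az <-] [t Bt /val_inj tz]]] := xy _ _ xA yB.
by exists z; split=> //; rewrite -tz.
Qed.

(** Singletons are sequentially closed: a constant sequence and its limit lie in one T1 member,
    where they must coincide. *)
Lemma absorbing_accessible : (forall n, accessible_space (X_ n)) ->
  sequential_space X -> accessible_space X.
Proof.
move=> T1 sX x y xy; exists (~` [set y]); split; last first.
- by rewrite inE /= => /(_ erefl).
- by rewrite inE /=; exact/eqP.
rewrite openC; apply: sX => u l uy ul /=.
have [k [uk lk]] := absorbing_cvg ul.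
pose v n : X_ k := SigSub (mem_set (uk n)).
pose l' : X_ k := SigSub (mem_set lk).
have [l'v|/T1[A [oA]]] := eqVneq l' (v 0%N).
  by rewrite -[l]/(\val l') l'v /= uy.
have vl : v n @[n --> \oo] --> l' by exact: cvg_set_type.
rewrite !inE => Al' nAv0.
have /vl [N _ /(_ N (leqnn N))] : nbhs l' A by exact: open_nbhs_nbhs.
by rewrite /= (_ : v N = v 0%N)//; apply: val_inj; rewrite /= !uy.
Qed.

Lemma absorbing_regular_nbhs (x : X) (U : set X) (n : nat) :
  regular_space (X_ n) -> nbhs x U ->
  exists2 W : set X, nbhs x W & closure (W `&` X_ n) `<=` U.
Proof.
move=> rX xU; have cX := @absorbing_closed n.
have [Xx|nXx] := pselect (X_ n x); last first.
  exists (~` X_ n); first by apply: open_nbhs_nbhs; split=> //; exact: closed_openC.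
  by rewrite setICl closure0; exact: sub0set.
pose x' : X_ n := SigSub (mem_set Xx).
have x'U : nbhs x' (set_val @^-1` U).
  by apply: (@initial_continuous _ _ (@set_val X (X_ n))); rewrite set_valE.
have [B /nbhs_set_typeP x'B BU] := rX x' _ x'U.
(* The largest set with trace [B] on [X_ n]; the closure of [B] in [X_ n] is already closed in
   [X]. *)
exists [set y | X_ n y -> (set_val @` B) y] => //.
have cB : closed (set_val @` closure B).
  by apply: closed_set_val => //; exact: closed_closure.
apply: (@subset_trans _ (set_val @` closure B)); last by move=> _ [y /BU ? <-].
rewrite [X in _ `<=` X]((closure_id _).1 cB); apply: closureS.
move=> y [/= + Xy] => /(_ Xy)[z Bz <-].
by exists z => //; exact: subset_closure.
Qed.

Lemma absorbing_regular : (forall n, regular_space (X_ n)) ->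
  frechet_urysohn_space X -> regular_space X.
Proof.
move=> rX fuX x U xU.
have /choice[W WP] : forall n, exists W : set X,
    nbhs x W /\ closure (W `&` X_ n) `<=` U.
  by move=> n; have [W] := absorbing_regular_nbhs (rX n) xU; exists W.
(* Testing only the least member containing z makes V meet each X_ k inside
   the finitely many sets W j `&` X_ j with j <= k. *)
pose V := [set z | exists n, [/\ X_ n z, W n z & forall k, X_ k z -> (n <= k)%N]].
exists V.
  apply: frechet_urysohn_nbhs => // u ux; have [k [uk xk]] := absorbing_cvg ux.
  have /ux[N _ /(_ N (leqnn N)) ON] : nbhs x [set y | forall j : 'I_k.+1, W j y].
    by apply: filter_forall => j; have [] := WP j.
  have exn : exists n, `[< X_ n (u N) >] by exists k; exact/asboolP.
  case: (ex_minnP exn) => n /asboolP Xn nmin; exists N, n; split=> //.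
    have nk : (n < k.+1)%N by rewrite ltnS; apply: nmin; exact/asboolP.
    exact: (ON (Ordinal nk)).
  by move=> j Xj; apply: nmin; exact/asboolP.
(* Along a sequence in [V] inside [X_ k], all least indices are at most [k]. Were [y] outside [U],
   it would have a neighbourhood missing the finitely many closures that contain the sequence. *)
move=> y /fuX[u Vu uy]; have [k [uk yk]] := absorbing_cvg uy.
apply: contrapT => nUy.
have /uy[N _ /(_ N (leqnn N)) nO] :
    nbhs y [set z | forall j : 'I_k.+1, (~` closure (W j `&` X_ j)) z].
  apply: filter_forall => j; apply: open_nbhs_nbhs; split.
    exact/closed_openC/closed_closure.
  by have [_ OU] := WP j; move/OU.
have [n [Xn On nmin]] := Vu N.
have nk : (n < k.+1)%N by rewrite ltnS; exact: nmin.
by apply: (nO (Ordinal nk)); exact: subset_closure.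
Qed.

(** * Normality from growing closed pairs *)

Lemma sequential_bigcup_open (P : nat -> set X) : sequential_space X ->
  (forall n x, P n x -> within (X_ n.+1) (nbhs x) (P n.+1)) ->
  (forall n, P n `<=` P n.+1) -> open (\bigcup_n P n).
Proof.
move=> sX nP PS; apply: sequential_open => // u l ul [m _ Pml].
have [k [uk lk]] := absorbing_cvg ul.
have Ple : {homo P : i j / (i <= j)%N >-> i `<=` j}.
  by apply: (homo_leq _ _ PS) => [A|A B C]//; exact: subset_trans.
(* At index [maxn m k] the limit is in [P], and the next member contains the whole sequence. *)
have := nP _ _ (Ple _ _ (leq_maxl m k) _ Pml); rewrite /within /= => /ul.
move=> [N _ /(_ N (leqnn N))/= PN]; exists N, (maxn m k).+1 => //; apply: PN.
by apply: absorbing_le (uk N); rewrite (leq_trans (leq_maxr m k)).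
Qed.

(** Closedness is taken in [X], so that a pair passes unchanged to the next member. *)
Definition closed_pair n (p : set X * set X) :=
  [/\ closed p.1, closed p.2, p.1 `<=` X_ n, p.2 `<=` X_ n & p.1 `&` p.2 = set0].

Lemma closed_pair_swap n p : closed_pair n p -> closed_pair n (p.2, p.1).
Proof. by case=> ? ? ? ? p0; split=> //=; rewrite setIC. Qed.

Lemma normal_closed_fst n p : normal_space (X_ n) -> closed_pair n p ->
  exists2 C, closed_pair n (C, p.2) &
    forall x, p.1 x -> within (X_ n) (nbhs x) C.
Proof.
move: p => [P Q] nX [/= cP cQ PX QX PQ0].
have cval (B : set X) : closed B -> closed (set_val @^-1` B : set (X_ n)).
  by apply: closed_comp => ? _; exact: initial_continuous.
have [x Px|B PB BQ] := nX _ (cval _ cP) (set_val @^-1` (~` Q)).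
  apply: initial_continuous; apply: open_nbhs_nbhs; split.
    exact: closed_openC.
  by move=> Qx; have : (P `&` Q) (set_val x) by []; rewrite PQ0.
exists (set_val @` closure B); first split=> //=.
- by apply: closed_set_val; [exact: absorbing_closed|exact: closed_closure].
- by move=> _ [y _ <-]; exact: set_valP.
- by rewrite -subset0 => _ [[y /BQ nQy <-]].
move=> x Px; have := PB (SigSub (mem_set (PX _ Px))) Px.
move=> /nbhs_set_typeP; rewrite /within /=.
apply: filterS => y /[apply] -[z Bz <-].
by exists z => //; exact: subset_closure.
Qed.

(** The second set is enlarged against the already enlarged first one, which keeps the two
    disjoint. *)
Lemma normal_closed_pair n p : normal_space (X_ n) -> closed_pair n p ->
  exists q, [/\ closed_pair n q,
    forall x, p.1 x -> within (X_ n) (nbhs x) q.1 &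
    forall x, p.2 x -> within (X_ n) (nbhs x) q.2].
Proof.
move=> nX /(normal_closed_fst nX)[C /closed_pair_swap pC p1C].
have [D /closed_pair_swap pD p2D] := normal_closed_fst nX pC.
by exists (C, D); split.
Qed.

Lemma absorbing_normal_open (A B : set X) : (forall n, normal_space (X_ n)) ->
  sequential_space X -> closed A -> closed B -> A `&` B = set0 ->
  exists U V, [/\ open U, open V, A `<=` U, B `<=` V & U `&` V = set0].
Proof.
move=> nX sX cA cB AB0.
pose inv n (p : set X * set X) :=
  [/\ closed_pair n p, A `&` X_ n `<=` p.1 & B `&` X_ n `<=` p.2].
(* With the invariant as a premise, a successor exists for every pair, and plain choice yields the
   recursion. *)
pose next n (p q : set X * set X) := inv n p -> inv n.+1 q /\
  [/\ forall x, p.1 x -> within (X_ n.+1) (nbhs x) q.1,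
      forall x, p.2 x -> within (X_ n.+1) (nbhs x) q.2,
      p.1 `<=` q.1 & p.2 `<=` q.2].
have within_mem n (C D : set X) : C `<=` X_ n ->
    (forall x, C x -> within (X_ n) (nbhs x) D) -> C `<=` D.
  by move=> CX CD x Cx; apply: (nbhs_singleton (CD x Cx)); exact: CX.
have step n p : exists q, next n p q.
  have [ip|] := pselect (inv n p); last by move=> nip; exists p.
  move: ip => [[cp1 cp2 p1X p2X p0] Ap Bp].
  have XX : X_ n `<=` X_ n.+1 by exact: absorbing_le.
  have cX := @absorbing_closed n.+1.
  (* The new parts of [A] and [B] are added before enlarging. A point of [p.1] in [B] lies in
     [X_ n], hence in [p.2], so disjointness survives; likewise for [p.2] and [A]. *)
  pose p' := (p.1 `|` A `&` X_ n.+1, p.2 `|` B `&` X_ n.+1).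
  have p'P : closed_pair n.+1 p'.
    split=> /=; [by apply: closedU => //; exact: closedI..| | |].
    - by move=> x [/p1X/XX|[]].
    - by move=> x [/p2X/XX|[]].
    rewrite -subset0 => x [[p1x|[Ax Xx]] [p2x|[Bx _]]]; last by rewrite -AB0.
    + by rewrite -p0.
    + by rewrite -p0; split=> //; apply: Bp; split=> //; exact: p1X.
    + by rewrite -p0; split=> //; apply: Ap; split=> //; exact: p2X.
  have [q [qP p1q p2q]] := normal_closed_pair (nX n.+1) p'P.
  have [_ _ p'1X p'2X _] := p'P.
  have p1q' := within_mem _ _ _ p'1X p1q; have p2q' := within_mem _ _ _ p'2X p2q.
  exists q => _; split; first by split=> // x Ax; [apply: p1q'|apply: p2q']; right.
  split=> x px; [apply: p1q|apply: p2q|apply: p1q'|apply: p2q']; by left.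
have i0 : exists p, inv 0%N p.
  exists (A `&` X_ 0%N, B `&` X_ 0%N); split=> //; split=> /=.
  - by apply: closedI => //; exact: absorbing_closed.
  - by apply: closedI => //; exact: absorbing_closed.
  - by move=> x [].
  - by move=> x [].
  - by rewrite -subset0 => x [[Ax _] [Bx _]]; rewrite -AB0.
have [p0 ip0] := i0.
have /choice[f fP] : forall np : nat * (set X * set X), exists q, next np.1 np.2 q.
  by move=> [n p]; exact: step.
pose P := fix P n := if n is m.+1 then f (m, P m) else p0.
have iP n : inv n (P n) by elim: n => // n /(fP (n, P n))[].
have PP n := (fP (n, P n) (iP n)).2.
have Ple i j : (i <= j)%N -> (P i).1 `<=` (P j).1 /\ (P i).2 `<=` (P j).2.
  apply: (@homo_leq _ P (fun p q => p.1 `<=` q.1 /\ p.2 `<=` q.2)).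
  - by move=> p; split.
  - move=> q p r [pq1 pq2] [qr1 qr2].
    by split; [exact: subset_trans qr1|exact: subset_trans qr2].
  - by move=> n; have [] := PP n.
exists (\bigcup_n (P n).1), (\bigcup_n (P n).2); split.
- by apply: sequential_bigcup_open => // n; have [] := PP n.
- by apply: sequential_bigcup_open => // n; have [] := PP n.
- move=> x Ax; have [n Xx] := absorbing_mem x; exists n => //.
  by have [_ + _] := iP n; apply.
- move=> x Bx; have [n Xx] := absorbing_mem x; exists n => //.
  by have [_ _] := iP n; apply.
rewrite -subset0 => x [[m _ Pm] [n _ Pn]].
have [[_ _ _ _ <-] _ _] := iP (maxn m n).
by split; [apply: (Ple _ _ (leq_maxl m n)).1|apply: (Ple _ _ (leq_maxr m n)).2].
Qed.

(** * Perfect normality and metrizability *)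

Lemma absorbing_Gdelta : (forall n (F : set (X_ n)), closed F -> Gdelta F) ->
  forall A : set X, closed A -> Gdelta A.
Proof.
move=> gX A cA.
have /choice[G GP] : forall n, exists G : nat -> set X,
    [/\ forall i, open (G i), forall i, A `<=` G i &
        forall x, X_ n x -> (forall i, G i x) -> A x].
  move=> n; have [|F oF AF] := gX n (set_val @^-1` A).
    by apply: closed_comp cA => ? _; exact: initial_continuous.
  (* [F i] together with everything outside [X_ n]: open in [X], because the rest of [X_ n] is
     closed in [X]. *)
  exists (fun i => ~` (set_val @` (~` F i))); split=> [i|i x Ax [y + yx]|x Xx Gx].
  - apply/closed_openC/closed_set_val; first exact: absorbing_closed.
    exact: open_closedC.
  - apply; have : (set_val @^-1` A) y by rewrite /= yx.
    by rewrite AF; exact.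
  - have : (\bigcap_i F i) (SigSub (mem_set Xx)).
      move=> i _; apply: contrapT => nF; apply: (Gx i).
      by exists (SigSub (mem_set Xx)).
    by rewrite -AF.
exists (fun k => if unpickle k is Some (n, i) then G n i else setT).
  by move=> k; case: unpickle => [[n i]|]; [have [] := GP n|exact: openT].
apply/seteqP; split=> x.
  move=> Ax k _; case: unpickle => // -[n i].
  by have [_ + _] := GP n; apply.
move=> Gx; have [n Xx] := absorbing_mem x; have [_ _ +] := GP n; apply=> // i.
by have := Gx (pickle (n, i)) I; rewrite pickleK.
Qed.

Lemma absorbing_metrizable (R : realType) :
  (forall n, metrizable_space R (X_ n)) -> first_countable_space X ->
  metrizable_space R X.
Proof.
move=> mX fcX.
have sX := frechet_urysohn_sequential (first_countable_frechet_urysohn fcX).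
have T1 : accessible_space X.
  by apply: absorbing_accessible => // n; exact: metrizable_accessible.
have /(@normal_separatorP R) nX : normal_space X.
  apply/(@normal_openP R) => A B; apply: absorbing_normal_open => // n.
  exact: metrizable_normal.
have gX := absorbing_Gdelta (fun n F => metrizable_Gdelta (mX n)).
(* The complements of the [F i] are closed sets whose union is the interior of [X_ n]. *)
have /choice[F FP] : forall n, exists F : nat -> set X,
    (forall i, open (F i)) /\ ~` (X_ n)° = \bigcap_i F i.
  move=> n; have [|F oF FE] := gX (~` (X_ n)°); last by exists F.
  by apply: open_closedC; exact: open_interior.
have /choice[f fP] : forall p : nat * nat, exists f : X -> R,
    [/\ continuous f, range f `<=` `[0%R, 1%R]%classic,
        f @` (~` (X_ p.1)°) `<=` [set 0%R] & f @` (~` F p.1 p.2) `<=` [set 1%R]].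
  move=> [n i] /=; apply/uniform_separatorP; have [oF FE] := FP n; apply: nX.
  - by apply: open_closedC; exact: open_interior.
  - exact: open_closedC.
  - by rewrite -subset0 FE => x [Fx]; apply; exact: Fx.
(* Codes of no pair merely repeat the function of (0, 0) with another factor. *)
pose dec k : nat * nat := odflt (0%N, 0%N) (unpickle k).
have f01 p x : (0 <= f p x <= 1)%R.
  have [_ f01 _ _] := fP p; have := f01 (f p x); rewrite /= in_itv/=.
  by apply; exists x.
have k0 k : (0 < k.+1%:R^-1 :> R)%R by rewrite invr_gt0.
apply: (@bumps_metrizable R X (fun k => X_ (dec k).1)
    (fun k x => k.+1%:R^-1 * f (dec k) x)%R) => //.
- move=> k x; apply: cvgM; first exact: cvg_cst.
  by have [+ _ _ _] := fP (dec k); apply.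
- move=> k x; have /andP[fx0 fx1] := f01 (dec k) x.
  by rewrite mulr_ge0 ?(ltW (k0 k))// ler_piMr// ltW.
- move=> k x; rewrite pmulr_rgt0// => fx; apply: interior_subset.
  apply: contrapT => nXx; have [_ _ f0 _] := fP (dec k).
  have fx0 : f (dec k) x = 0%R by apply: f0; exists x.
  by rewrite fx0 ltxx in fx.
(* First countability puts [x] in the interior of some [X_ n], hence in a closed piece where the
   Urysohn function is 1. *)
- move=> x; have [n xn] := absorbing_first_countable_nbhs fcX x.
  have [oF FE] := FP n.
  have [i nFx] : exists i, (~` F n i) x.
    apply: contrapT => nF; have : (~` (X_ n)°) x; last by apply.
    by rewrite FE => i _; apply: contrapT => nFx; apply: nF; exists i.
  exists (pickle (n, i)); rewrite /dec pickleK /= pmulr_rgt0//.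
  have [_ _ _ f1] := fP (n, i).
  by rewrite (f1 (f (n, i) x)) ?ltr01//; exists x.
Qed.

End absorbing.

Theorem proposition2p3 (R : realType) (X : topologicalType) (X_ : nat -> set X)
    (hX : sequentially_absorbing X_) :
  (forall (Y : topologicalType) (f : X -> Y),
     (forall n, continuous (sigL (X_ n) f)) -> sequentially_continuous f) /\
  (forall (Y : topologicalType) (f : Y -> X),
     first_countable_space Y -> continuous f ->
     forall y : Y, exists U : set Y, exists n : nat,
       nbhs y U /\ f @` U `<=` X_ n) /\
  ((forall n, hausdorff_space (X_ n)) -> first_countable_space X ->
     hausdorff_space X) /\
  ((forall n, T1_regular_space (X_ n)) -> frechet_urysohn_space X ->
     T1_regular_space X) /\
  (((forall n, T1_normal_space (X_ n)) -> sequential_space X ->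
      T1_normal_space X) /\
   ((forall n, perfectly_normal_space (X_ n)) -> sequential_space X ->
      perfectly_normal_space X)) /\
  ((forall n, metrizable_space R (X_ n)) -> first_countable_space X ->
     metrizable_space R X).
Proof.
have T1_normal : (forall n, T1_normal_space (X_ n)) -> sequential_space X ->
    T1_normal_space X.
  move=> nX sX; split.
    by apply: (absorbing_accessible hX) => // n; have [] := nX n.
  apply/(@normal_openP R) => A B; apply: (absorbing_normal_open hX) => // n.
  by have [] := nX n.
split; first exact: absorbing_sequentially_continuous.
split; first exact: absorbing_nbhs_image.
split; first exact: absorbing_hausdorff.
split.
  move=> rX fuX; split.
    apply: (absorbing_accessible hX); last exact: frechet_urysohn_sequential.
    by move=> n; have [] := rX n.
  by apply: (absorbing_regular hX) => // n; have [] := rX n.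
split; last exact: absorbing_metrizable.
split=> // pX sX; split.
  by apply: T1_normal => // n; have [] := pX n.
by apply: (absorbing_Gdelta hX) => n; have [] := pX n.
Qed.
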